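(* Let $D$ be a digraph of order $n$ with minimum in-degree $\delta^-\ge1$. Then $L_2(D)\le \frac{2n}{\delta^-+1}$, with equality if and only if $D\in\Omega$.
   Context: Digraphs are finite, without loops or multiple arcs (opposite arcs allowed). $N^+[v]=N^+(v)\cup\{v\}$. A $2$-limited packing is a set $B\subseteq V(D)$ with $|N^+[v]\cap B|\le2$ for every vertex $v$; $L_2(D)$ is its maximum size. A digraph is functional if every vertex has out-degree exactly one. The family $\Omega$: start with a functional digraph $D'$ with $V(D')=\{v_1,\dots,v_{n'}\}$. Choose an integer $r\ge\Delta^-(D')$ (maximum in-degree of $D'$) such that $p=(r-1)n'$ is even. Add a set of new vertices $U=\{u_1,\dots,u_{p/2}\}$ and new arcs of the form $(u_i,v_j)$ such that (i) every $u_i$ is incident with precisely two such arcs, and (ii) $\deg^-(v_j)=r$ for all $1\le j\le n'$. Then add some arcs among the vertices of $U$ and some arcs from $V(D')$ to $U$, such that $r$ is the minimum in-degree of the resulting digraph. $\Omega$ is the family of all digraphs obtained this way. *)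

(* Defs.v *)
From mathcomp Require Import all_boot all_order all_algebra.

Set Implicit Arguments.
Unset Strict Implicit.
Unset Printing Implicit Defensive.

Record digraph := Digraph {
  vertex :> finType;
  arc : rel vertex;
  arc_irr : irreflexive arc
}.

Definition out_nbhd (D : digraph) (v : D) : {set D} := [set w | arc v w].

Definition in_nbhd (D : digraph) (v : D) : {set D} := [set u | arc u v].

Definition closed_out_nbhd (D : digraph) (v : D) : {set D} := v |: out_nbhd v.

Definition out_degree (D : digraph) (v : D) : nat := #|out_nbhd v|.

Definition in_degree (D : digraph) (v : D) : nat := #|in_nbhd v|.

(* In-degrees are smaller than #|D|, so the default value #|D| only matters
   when D has no vertex, in which case the result is 0. *)
Definition min_in_degree (D : digraph) : nat :=
  \big[minn/#|D|]_(v : D) in_degree v.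

Definition max_in_degree (D : digraph) : nat := \max_(v : D) in_degree v.

Definition functional (D : digraph) : Prop := forall v : D, out_degree v = 1.

Definition limited_packing (k : nat) (D : digraph) (B : {set D}) : bool :=
  [forall v : D, #|closed_out_nbhd v :&: B| <= k].

Definition limited_packing_number (k : nat) (D : digraph) : nat :=
  \max_(B : {set D} | limited_packing k B) #|B|.

Definition digraph_iso (D E : digraph) : Prop :=
  exists f : D -> E, bijective f /\ forall u v : D, arc (f u) (f v) = arc u v.

Section Extend.

(* The digraph obtained from D by adding the vertices in U, the arcs toD from U
   to D, the arcs inU among the vertices of U and the arcs toU from D to U. *)
Variables (D : digraph) (U : finType).
Variables (toD : U -> D -> bool) (inU : rel U) (toU : D -> U -> bool).

Definition extend_arc : rel (D + U)%type := fun x y =>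
  match x, y with
  | inl v, inl w => arc v w
  | inr u, inl v => toD u v
  | inr u, inr u' => inU u u'
  | inl v, inr u => toU v u
  end.

Hypothesis inU_irr : irreflexive inU.

Lemma extend_arc_irr : irreflexive extend_arc.
Proof. by case=> [v|u] /=; [apply: arc_irr | apply: inU_irr]. Qed.

Definition extend : digraph := Digraph extend_arc_irr.

End Extend.

Definition extend_toD (D : digraph) (U : finType) (toD : U -> D -> bool) :
    digraph :=
  extend (inU := fun _ _ => false) toD (fun _ _ => false) (fun=> erefl).

(* The family is closed under isomorphism.  The requirement deg^-(v) = r is
   imposed before the arcs with head in U are added.  The truncated r - 1 is
   harmless: r = 0 forces max_in_degree D' = 0, hence D' empty and p = 0. *)
Definition Omega (D : digraph) : Prop :=
  exists (D' : digraph) (r : nat),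
    let p := (r - 1) * #|D'| in
    [/\ functional D', max_in_degree D' <= r, ~~ odd p &
    exists toD : 'I_(p./2) -> D' -> bool,
      [/\ forall u, #|[set v | toD u v]| = 2,
          forall v : D', in_degree (inl v : extend_toD toD) = r &
      exists (inU : rel 'I_(p./2)) (inU_irr : irreflexive inU)
             (toU : D' -> 'I_(p./2) -> bool),
        min_in_degree (extend toD toU inU_irr) = r /\
        digraph_iso D (extend toD toU inU_irr)]].

(* Main.v *)
(* Counting the pairs (v, b) with b in B and b in N^+[v] in two ways gives
   (delta^- + 1) |B| <= 2 n for every 2-limited packing B.  Equality forces
   every vertex of B to have in-degree delta^- and every N^+[v] to meet B in
   exactly two vertices, so that B induces a functional digraph D' and every
   vertex outside B sends exactly two arcs into B: this is the structure of
   Omega, with U the complement of B.  Conversely, in a member of Omega the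
   vertices of D' form a 2-limited packing of size 2 n / (r + 1). *)

From mathcomp Require Import all_boot all_order all_algebra.
From mathcomp Require Import zify.
Require Import Defs.

Set Implicit Arguments.
Unset Strict Implicit.
Unset Printing Implicit Defensive.

(** The iterated [minn] starts from [#|D|]; this default value is the source of the first conjunct,
    which decides the case of an empty [D]. *)
Lemma leq_min_in_degree (D : digraph) (m : nat) :
  (m <= min_in_degree D) =
    (m <= #|D|) && [forall v : D, m <= in_degree v].
Proof.
have <- : \big[andb/true]_(v : D) (m <= in_degree v) =
    [forall v : D, m <= in_degree v] by rewrite big_andE.
rewrite /min_in_degree.
elim/big_rec2: _ => [|v b x _ IH]; first by rewrite andbT.
by rewrite leq_min IH andbCA.
Qed.

Lemma min_in_degree_le (D : digraph) (v : D) : min_in_degree D <= in_degree v.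
Proof.
by move: (leqnn (min_in_degree D)); rewrite leq_min_in_degree => /andP[_ /forallP].
Qed.

Lemma min_in_degree_le_card (D : digraph) : min_in_degree D <= #|D|.
Proof.
by move: (leqnn (min_in_degree D)); rewrite leq_min_in_degree => /andP[].
Qed.

Section Isomorphism.
Variables (D E : digraph) (f : D -> E).
Hypothesis f_bij : bijective f.
Hypothesis f_arc : forall u v, arc (f u) (f v) = arc u v.

Lemma in_degree_iso (v : D) : in_degree (f v) = in_degree v.
Proof.
rewrite /in_degree -(on_card_preimset (f := f)); last exact: onW_bij.
by apply: eq_card => u; rewrite !inE f_arc.
Qed.

Lemma min_in_degree_iso : min_in_degree D = min_in_degree E.
Proof.
have [g fK gK] := f_bij.
apply/eqP; rewrite eqn_leq !leq_min_in_degree; apply/andP; split; apply/andP; split.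
- by rewrite -(bij_eq_card f_bij) min_in_degree_le_card.
- by apply/forallP => v; rewrite -[v]gK in_degree_iso min_in_degree_le.
- by rewrite (bij_eq_card f_bij) min_in_degree_le_card.
- by apply/forallP => v; rewrite -in_degree_iso min_in_degree_le.
Qed.

End Isomorphism.

Section DoubleCounting.
Variable D : digraph.
Implicit Types (v : D) (B : {set D}).

Lemma sum_closed_out_nbhd B :
  \sum_v #|closed_out_nbhd v :&: B| = \sum_(b in B) (in_degree b).+1.
Proof.
transitivity (\sum_v \sum_(b in B) (b \in closed_out_nbhd v : nat)).
  apply: eq_bigr => v _; rewrite -sum1_card big_mkcond [RHS]big_mkcond /=.
  by apply: eq_bigr => b _; rewrite in_setI andbC; case: (b \in B) => //=; case: ifP.
rewrite exchange_big; apply: eq_bigr => b _ /=.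
(* After the exchange of sums, [b] is counted once for itself and once for each in-neighbour. *)
transitivity #|b |: in_nbhd b|.
  rewrite -sum1_card [RHS]big_mkcond /=; apply: eq_bigr => v _.
  by rewrite !inE eq_sym; case: ifP.
by rewrite cardsU1 inE arc_irr.
Qed.

(** Two termwise estimates of the double count are chained: in-degrees from below, intersections
    with [B] from above. Stating them with [leqif] lets the equality conditions accumulate along the
    chain. *)
Lemma limited_packing_card (k : nat) B : limited_packing k B ->
  #|B| * (min_in_degree D).+1 <= k * #|D|
    ?= iff [forall b in B, in_degree b == min_in_degree D]
        && [forall v, #|closed_out_nbhd v :&: B| == k].
Proof.
move=> /forallP packB.
have lb : #|B| * (min_in_degree D).+1 <= \sum_(b in B) (in_degree b).+1
    ?= iff [forall b in B, in_degree b == min_in_degree D].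
  rewrite -sum_nat_const; apply: leqif_sum => b _; split.
    exact: min_in_degree_le.
  by rewrite eqSS eq_sym.
have ub : \sum_v #|closed_out_nbhd v :&: B| <= k * #|D|
    ?= iff [forall v, #|closed_out_nbhd v :&: B| == k].
  rewrite mulnC -sum_nat_const; apply: leqif_sum => v _; split=> //.
by apply: leqif_trans lb _; rewrite -sum_closed_out_nbhd.
Qed.

Lemma limited_packing_number_witness (k : nat) :
  exists2 B : {set D}, limited_packing k B & #|B| = limited_packing_number k D.
Proof.
have pack0 : limited_packing k (set0 : {set D}).
  by apply/forallP => v; rewrite setI0 cards0.
have [B packB eqB] : {B : {set D} | limited_packing k B &
    limited_packing_number k D = #|B|}.
  by apply: eq_bigmax_cond; apply/card_gt0P; exists set0.
by exists B.
Qed.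

Lemma limited_packing_number_bound (k : nat) :
  limited_packing_number k D * (min_in_degree D).+1 <= k * #|D|.
Proof.
have [B packB <-] := limited_packing_number_witness k.
exact: (limited_packing_card packB).
Qed.

End DoubleCounting.

Lemma Omega_limited_packing_number (D : digraph) : 0 < min_in_degree D ->
  Omega D -> limited_packing_number 2 D * (min_in_degree D).+1 = 2 * #|D|.
Proof.
move=> r_gt0 [D' [r [fun_D' _ p_even [toD [toD2 _ [inU [inU_irr [toU]]]]]]]].
case=> min_r [f [f_bij f_arc]].
have r_eq : min_in_degree D = r by rewrite (min_in_degree_iso f_bij f_arc).
have cardD : #|D| = #|D'| + ((r - 1) * #|D'|)./2.
  by rewrite (bij_eq_card f_bij) card_sum card_ord.
apply/eqP; rewrite eqn_leq limited_packing_number_bound r_eq.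
(* Write n' for [#|D'|]. As [D] has n' + (r - 1)n'/2 vertices, 2[#|D|] = n'(r + 1), so a packing of
   size n' attains the bound. Positivity of [r] makes [r - 1] a genuine subtraction. *)
suff le_L : #|D'| <= limited_packing_number 2 D.
  apply: leq_trans (leq_mul le_L (leqnn r.+1)).
  rewrite r_eq in r_gt0; rewrite cardD; move: p_even r_gt0; case: r {toD toD2
    inU inU_irr toU min_r f f_bij f_arc r_eq cardD le_L} => // r.
  by rewrite subSS subn0 => /even_halfK; nia.
have [g fK gK] := f_bij.
pose B : {set D} := f @^-1: (inl @: [set: D']).
have cardB : #|B| = #|D'|.
  rewrite on_card_preimset; last exact: onW_bij.
  by rewrite card_imset ?cardsT // => x y [].
have memB w : g (inl w) \in B by rewrite inE gK imset_f ?inE.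
have inB x : x \in B -> exists w, x = g (inl w).
  by rewrite inE => /imsetP[w _ fx]; exists w; rewrite -fx fK.
rewrite -cardB; apply: (leq_bigmax_cond (P := fun B => limited_packing 2 B)).
have g_inl_inj : injective (fun w => g (inl w)).
  by move=> w1 w2 /(can_inj gK) [].
apply/forallP => x; rewrite -[x]fK; case: (f x) => [v|u].
  (* Arcs of [toU] end outside [B], so only the copies of [v] and of its single out-neighbour in
     [D'] are met. *)
  rewrite (_ : _ :&: B = (fun w => g (inl w)) @: (v |: out_nbhd v)); last first.
    apply/setP => y; apply/setIP/imsetP => [[] yN /inB[w y_eq]|[w wN ->]].
      exists w => //; move: yN; rewrite y_eq !inE -f_arc !gK /=.
      by rewrite (inj_eq g_inl_inj).
    split=> //; move: wN; rewrite !inE -f_arc !gK /=.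
    by rewrite (inj_eq g_inl_inj).
  rewrite card_imset // cardsU1 inE arc_irr.
  by have := fun_D' v; rewrite /out_degree => ->.
(* The vertex coming from [u] lies outside [B], as do the heads of [inU]; the two arcs of [toD]
   remain. *)
rewrite (_ : _ :&: B = (fun w => g (inl w)) @: [set v | toD u v]); last first.
  apply/setP => y; apply/setIP/imsetP => [[] yN /inB[w y_eq]|[w wN ->]].
    exists w => //; move: yN; rewrite y_eq !inE -f_arc !gK /=.
    by rewrite (inj_eq (can_inj gK)).
  split=> //; move: wN; rewrite !inE -f_arc !gK /=.
  by move=> ->; rewrite orbT.
by rewrite card_imset // toD2.
Qed.

Lemma limited_packing_number_Omega (D : digraph) : 0 < min_in_degree D ->
  limited_packing_number 2 D * (min_in_degree D).+1 = 2 * #|D| -> Omega D.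
Proof.
move=> r_gt0; have [B packB <-] := limited_packing_number_witness D 2.
set r := min_in_degree D in r_gt0 * => cardB_eq.
have [_] := limited_packing_card packB.
rewrite cardB_eq eqxx => /esym /andP[/forall_inP inB /forallP outB].
have arcB_irr : irreflexive (fun x y : {x | x \in B} => arc (val x) (val y)).
  by move=> x; rewrite arc_irr.
pose D' := Digraph arcB_irr.
have cardD' : #|D'| = #|B| by rewrite card_sig; apply: eq_card.
(* Solve |B|(r + 1) = 2(|B| + |~: B|) for the size of the complement; the same equation gives the
   parity below. *)
have cardBC : #|~: B| = ((r - 1) * #|D'|)./2.
  have := cardsC B; rewrite cardD'; case: (r) r_gt0 cardB_eq => // s _.
  by rewrite subSS subn0; lia.
have p_even : ~~ odd ((r - 1) * #|D'|).
  have := cardsC B; rewrite cardD'; case: (r) r_gt0 cardB_eq => // s _.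
  by rewrite subSS subn0; lia.
exists D', r => /=.
pose U := 'I_(((r - 1) * #|D'|)./2).
(* [Omega] indexes the new vertices by an ordinal type, so the complement of [B] is enumerated
   through [cardBC]. All arcs are then pulled back along [g]. *)
pose g (x : D' + U) : D :=
  match x with
  | inl b => val b
  | inr i => enum_val (cast_ord (esym cardBC) i)
  end.
have gU i : g (inr i) \notin B.
  by have := enum_valP (cast_ord (esym cardBC) i); rewrite inE.
have gD b : g (inl b) \in B by exact: (valP b).
have g_inj : injective g.
  move=> [b|i] [c|j] eq_g.
  - by congr inl; apply: val_inj.
  - by move: (gU j); rewrite -eq_g gD.
  - by move: (gU i); rewrite eq_g gD.
  - by congr inr; apply: (cast_ord_inj (eq_n := esym cardBC)); apply: enum_val_inj.
have g_bij : bijective g.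
  apply: inj_card_bij => //.
  by rewrite card_sum card_ord -cardBC cardD' cardsC.
have card_val (A : {set D}) : #|[set b : D' | val b \in A]| = #|A :&: B|.
  rewrite -(card_imset _ val_inj); apply: eq_card => y.
  apply/imsetP/setIP => [[b]|[yA yB]]; first by rewrite inE => bA ->; split=> //; exact: (valP b).
  by exists (Sub y yB); rewrite ?inE SubK.
pose toD (u : U) (v : D') := arc (g (inr u)) (g (inl v)).
pose toU (v : D') (u : U) := arc (g (inl v)) (g (inr u)).
pose inU (u w : U) := arc (g (inr u)) (g (inr w)).
have inU_irr : irreflexive inU by move=> u; rewrite /inU arc_irr.
pose E := extend toD toU inU_irr.
have g_arc (x y : E) : arc (g x) (g y) = arc x y by case: x; case: y.
have in_deg_inl (v : D') : in_degree (inl v : E) = r.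
  by rewrite -(in_degree_iso (D := E) g_bij g_arc); apply/eqP/inB.
split=> //.
(* Of the two elements of [B] in the closed out-neighbourhood, one is the vertex itself; the other
   is its only out-neighbour in [D']. *)
- move=> v; have /eqP := outB (val v).
  rewrite /closed_out_nbhd setIUl (setIidPl _) ?sub1set ?(valP v) //.
  rewrite cardsU1 !inE arc_irr /= add1n => -[<-].
  rewrite /out_degree -card_val.
  by apply: eq_card => w; rewrite !inE.
(* In-neighbours inside [D'] are among the [r] in-neighbours in the whole digraph. *)
- apply/bigmax_leqP => v _; rewrite -(in_deg_inl v) /in_degree.
  have inl_inj : injective (inl : D' -> D' + U) by move=> ? ? [].
  rewrite -(card_imset _ inl_inj); apply: subset_leq_card.
  by apply/subsetP => _ /imsetP[w + ->]; rewrite !inE.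
- exists toD; split.
  + move=> u; have /eqP := outB (g (inr u)).
    rewrite /closed_out_nbhd setIUl (_ : [set _] :&: B = set0) ?set0U; last first.
      by apply/setP => y; rewrite !inE; case: eqP => // ->; apply/negbTE/gU.
    by move=> <-; rewrite -card_val; apply: eq_card => w; rewrite !inE.
  (* Arcs with head in [U] do not affect the in-degree of [inl v]. *)
  + move=> v; apply: etrans (in_deg_inl v); rewrite /in_degree.
    by apply: eq_card => -[w|w]; rewrite !inE.
  + exists inU, inU_irr, toU; split.
      exact: (min_in_degree_iso (D := E) g_bij g_arc).
    have [f gK fK] := g_bij.
    exists f; split; first by exists g.
    by move=> x y; rewrite -g_arc !fK.
Qed.

Local Open Scope ring_scope.
Import GRing.Theory Num.Theory.

Theorem theorem2 (D : digraph) (hdelta : (1 <= min_in_degree D)%N) :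
  ((limited_packing_number 2 D)%:R : rat)
    <= (2 * #|D|)%:R / ((min_in_degree D).+1)%:R
  /\ (((limited_packing_number 2 D)%:R : rat)
        = (2 * #|D|)%:R / ((min_in_degree D).+1)%:R <-> Omega D).
Proof.
split.
  by rewrite ler_pdivlMr ?ltr0n // -natrM ler_nat limited_packing_number_bound.
have d_neq0 : ((min_in_degree D).+1)%:R != 0 :> rat by rewrite pnatr_eq0.
split=> [eqL | /(Omega_limited_packing_number hdelta) <-].
  apply: limited_packing_number_Omega => //; apply/eqP.
  by rewrite -(eqr_nat rat) natrM eqL divfK.
by rewrite natrM mulfK.
Qed.
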